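(* For all positive integers $n,p$, $$\beta(n,p,4)=O\left(n^{3/4}p^{1/2}+n^{5/8}p^{11/16}+n+p\right).$$
   Context: A path system is a pair $S=(V,\Pi)$ where $V$ is a finite ground set of nodes and $\Pi$ is a multiset of finite sequences of nodes (paths), each path containing each node at most once. The size is $\|S\|=\sum_{\pi\in\Pi}|\pi|$, where $|\pi|$ is the number of nodes of $\pi$. Write $x<_\pi y$ if $x,y\in\pi$ and $x$ strictly precedes $y$ in $\pi$. A $b$-bridge consists of $b$ distinct nodes $v_1,\dots,v_b$ and $b$ distinct paths $\pi_1,\dots,\pi_b$ with $v_i<_{\pi_i}v_{i+1}$ for $1\le i\le b-1$ and $v_1<_{\pi_b}v_b$. The bridge girth of $S$ is the least $b$ for which $S$ has a $b$-bridge ($\infty$ if none). $\beta(n,p,k)$ is the maximum possible size of a path system with $n$ nodes, $p$ paths, and bridge girth $>k$. *)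

(* Defs.v *)
From mathcomp Require Import all_boot.
Set Implicit Arguments. Unset Strict Implicit. Unset Printing Implicit Defensive.

Definition precedes (T : eqType) (pi : seq T) (x y : T) : bool :=
  [&& x \in pi, y \in pi & index x pi < index y pi].

(* A path system with node set 'I_n and p paths: a list (multiset) of p
   sequences of nodes, each containing every node at most once. *)
Definition is_path_system (n p : nat) (P : seq (seq 'I_n)) : Prop :=
  size P = p /\ all uniq P.

Definition ps_size (n : nat) (P : seq (seq 'I_n)) : nat := sumn (map size P).

(* A b-bridge: distinct nodes v_0..v_{b-1}, distinct paths (indices into the
   list P, so distinct as members of the multiset) pi_0..pi_{b-1}, with
   v_i <_{pi_i} v_{i+1} for i+1 < b and v_0 <_{pi_{b-1}} v_{b-1}. *)
Definition has_bridge (n : nat) (P : seq (seq 'I_n)) (b : nat) : Prop :=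
  0 < b /\
  exists (v : nat -> 'I_n) (pi : nat -> nat),
    {in gtn b &, injective v} /\ {in gtn b &, injective pi} /\
    (forall i, i < b -> pi i < size P) /\
    (forall i, i.+1 < b -> precedes (nth [::] P (pi i)) (v i) (v i.+1)) /\
    precedes (nth [::] P (pi b.-1)) (v 0) (v b.-1).

Definition bridge_girth_gt (n : nat) (P : seq (seq 'I_n)) (k : nat) : Prop :=
  forall b, b <= k -> ~ has_bridge P b.

(* Main.v *)
Require Import Defs.
From mathcomp Require Import all_boot.
From mathcomp Require Import zify.
Set Implicit Arguments. Unset Strict Implicit. Unset Printing Implicit Defensive.

(** Write [L] for the size, [d = L/n] for the average degree and [l = L/p] for the
    average length.  Two paths that meet twice do so in opposite orders, and
    3-bridge-freeness lets at most two paths through a node of a path [a] meet [a]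
    again, so almost all crossings are clean (a single common node).

    A rung from a path [s] to a path [r] is an edge [y -> w] along a third path with
    [y] on [s] and [w] on [r].  Excluding 3- and 4-bridges makes the rungs from [s] to
    [r] a strictly monotone chain, so among the about [d l^3 / n] rungs of a typical
    pair most are close to the next one on both paths.  This gives many quads
    [y -> y' -> w'], [y -> w -> w'] whose edges [y -> y'] and [w -> w'] are short.
    By Cauchy-Schwarz over the base [(y, y', w')], there are many pairs of quads over
    a common base, that is, many short cherries [w1 -> w' <- w2] with common
    in-neighbours [y].  But [w1] and [w2] have at most [d] common in-neighbours, one
    for each path through [w1].  Comparing the counts yields
    [L = O(n^(3/4) p^(1/2) + n^(3/5) p^(7/10) + n^(1/2) p^(3/4) + n + p)], and both
    middle terms are at most the larger of [n^(5/8) p^(11/16)] and [p]. *)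

(** * Double counting *)

Section Counting.
Variables (T A : finType) (f : T -> A) (S : {set T}) (A0 : {set A}).
Hypothesis fS : {in S, forall x, f x \in A0}.

Lemma card_fibers : #|S| = \sum_(a in A0) #|[set x in S | f x == a]|.
Proof.
rewrite -sum1_card (partition_big f (mem A0)) //.
by apply: eq_bigr => a _; rewrite -sum1dep_card.
Qed.

Lemma leq_card_fibers k :
  {in A0, forall a, #|[set x in S | f x == a]| <= k} -> #|S| <= #|A0| * k.
Proof. by move=> fk; rewrite card_fibers -sum_nat_const; apply: leq_sum. Qed.

Lemma leq_card_choice (B : finType) (g : T -> B) (G : A -> {set B}) k :
    {in S, forall x, g x \in G (f x)} ->
    {in S &, forall x y, f x = f y -> g x = g y -> x = y} ->
    {in A0, forall a, #|G a| <= k} ->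
  #|S| <= #|A0| * k.
Proof.
move=> gG inj cG; apply: leq_card_fibers => a aA.
have gi : {in [set x in S | f x == a] &, injective g}.
  by move=> x y; rewrite !inE => /andP[xS /eqP fx] /andP[yS /eqP fy] /inj->; rewrite ?fx.
rewrite -(card_in_imset gi); apply: leq_trans (cG a aA); apply/subset_leq_card/subsetP => b.
by case/imsetP => x; rewrite inE => /andP[xS /eqP <-] ->; apply: gG.
Qed.

(** Cauchy-Schwarz, obtained by summing [2 * (a x * a y) <= a x ^ 2 + a y ^ 2] over all pairs. *)
Lemma sqr_sum_leq (a : A -> nat) :
  (\sum_(x in A0) a x) ^ 2 <= #|A0| * \sum_(x in A0) a x ^ 2.
Proof.
rewrite -(leq_pmul2l (isT : 0 < 2)) -mulnn big_distrlr /= mulnCA.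
have -> : #|A0| * (2 * \sum_(x in A0) a x ^ 2)
    = \sum_(x in A0) \sum_(y in A0) (a x ^ 2 + a y ^ 2).
  under [in RHS]eq_bigr do rewrite big_split /= sum_nat_const.
  by rewrite big_split /= sum_nat_const -big_distrr /= mul2n -addnn mulnDr.
rewrite big_distrr /=; apply: leq_sum => x _.
by rewrite big_distrr /=; apply: leq_sum => y _; rewrite nat_Cauchy.
Qed.

(** Cauchy-Schwarz on the fibre sizes: the sum of their squares counts the ordered pairs with equal
    image, diagonal included. *)
Lemma sqr_card_leq_collisions :
  #|S| ^ 2 <= #|A0| * #|[set xy : T * T | [&& xy.1 \in S, xy.2 \in S & f xy.1 == f xy.2]]|.
Proof.
apply: (leq_trans (n := #|A0| * \sum_(a in A0) #|[set x in S | f x == a]| ^ 2)).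
  by rewrite {1}card_fibers sqr_sum_leq.
rewrite leq_mul2l; apply/orP; right.
under eq_bigr do rewrite -mulnn -cardsX.
rewrite -[X in _ <= X]sum1_card (partition_big (fun xy => f xy.1) (mem A0)) /=; last first.
  by move=> xy; rewrite inE => /and3P[/fS].
apply: leq_sum => a _; rewrite -sum1_card; apply: eq_leq; apply: eq_bigl => -[x y].
rewrite !inE /=; case: (x \in S); case: (y \in S); rewrite ?andbF //=.
by case: eqP => [->|]; rewrite ?andbT ?andbF // eq_sym.
Qed.

End Counting.

Lemma geq_card_fibers (T A : finType) (f : T -> A) (S : {set T}) (A0 : {set A}) k :
  {in A0, forall a, k <= #|[set x in S | f x == a]|} -> #|A0| * k <= #|S|.
Proof.
move=> fk; apply: (leq_trans (n := #|[set x in S | f x \in A0]|)).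
  rewrite (@card_fibers _ _ f _ A0); last by move=> x; rewrite inE => /andP[].
  rewrite -sum_nat_const; apply: leq_sum => a aA; apply: leq_trans (fk a aA) _.
  apply/subset_leq_card/subsetP => x; rewrite !inE => /andP[-> /eqP ->]; by rewrite aA eqxx.
by apply/subset_leq_card/subsetP => x; rewrite inE => /andP[].
Qed.

Lemma card_bounded_keys (A : finType) (K : A -> nat) N :
  #|[set ak : A * 'I_N | ak.2 < K ak.1]| <= \sum_a K a.
Proof.
rewrite (@card_fibers _ _ fst _ setT) => [|x _]; last by rewrite inE.
apply: (leq_trans (n := \sum_(a in [set: A]) K a)); last by apply: eq_leq; apply: eq_bigl => a; rewrite inE.
apply: leq_sum => a _.
have inj : {in [set x in [set ak : A * 'I_N | ak.2 < K ak.1] | x.1 == a] &,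
    injective (fun x : A * 'I_N => val x.2)}.
  move=> [x1 x2] [y1 y2]; rewrite !inE /= => /andP[_ /eqP ->] /andP[_ /eqP ->] e.
  by congr pair; apply: val_inj.
rewrite cardE -(size_map (fun x : A * 'I_N => val x.2)) -[K a](size_iota 0).
apply: uniq_leq_size.
  rewrite map_inj_in_uniq ?enum_uniq // => x y; rewrite !mem_enum; exact: inj.
move=> k /mapP[[x1 x2]]; rewrite mem_enum !inE /= => /andP[lt /eqP e] ->.
by rewrite mem_iota /= -e.
Qed.


Lemma leq_card_dep (A B : finType) (A0 : {set A}) (G : A -> {set B}) k :
    {in A0, forall a, #|G a| <= k} ->
  #|[set x : A * B | (x.1 \in A0) && (x.2 \in G x.1)]| <= #|A0| * k.
Proof.
apply: (@leq_card_choice _ _ fst _ _ _ _ snd G) => [x|x|[a b] [c d]]; rewrite !inE /=.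
- by case/andP.
- by case/andP.
by move=> _ _ -> ->.
Qed.

(** * Rungs and quads in bridge-free systems *)

Section BridgeFree.
Variables (V P : finType) (inc : P -> V -> bool) (pos : P -> V -> nat).

Definition before a x y := [&& inc a x, inc a y & pos a x < pos a y].

Hypothesis pos_inj : forall a x y, inc a x -> inc a y -> pos a x = pos a y -> x = y.
Hypothesis no_2bridge : forall a b x y, before a x y -> before b x y -> a = b.
Hypothesis no_3bridge : forall a b c x y z, uniq [:: a; b; c] ->
  before a x y -> before b y z -> ~~ before c x z.
Hypothesis no_4bridge : forall a b c d x y z w, uniq [:: a; b; c; d] ->
  before a x y -> before b y z -> before c z w -> ~~ before d x w.

(** * Clean crossings of two paths *)

Definition clean a b x :=
  [&& a != b, inc a x, inc b x & [forall z, inc a z && inc b z ==> (z == x)]].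

Lemma cleanC a b x : clean a b x = clean b a x.
Proof.
rewrite /clean eq_sym; congr andb; rewrite andbCA; do 2!congr andb.
by apply: eq_forallb => z; rewrite andbC.
Qed.

Lemma clean_neq a b x : clean a b x -> a != b. Proof. by case/and4P. Qed.
Lemma clean_incl a b x : clean a b x -> inc a x. Proof. by case/and4P. Qed.
Lemma clean_incr a b x : clean a b x -> inc b x. Proof. by case/and4P. Qed.

Lemma clean_uniq a b x z : clean a b x -> inc a z -> inc b z -> z = x.
Proof. by case/and4P => _ _ _ /forallP/(_ z)/implyP h az bz; apply/eqP/h/andP. Qed.

Lemma before_total a x y : inc a x -> inc a y -> [|| x == y, before a x y | before a y x].
Proof.
move=> ax ay; rewrite /before ax ay /=.
case: (ltngtP (pos a x) (pos a y)) => [||/(pos_inj ax ay)->]; rewrite ?orbT ?eqxx //.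
Qed.

Lemma before_asym a x y : before a x y -> before a y x -> False.
Proof. by move=> /and3P[_ _ xy] /and3P[_ _]; lia. Qed.

(** If [x] came strictly before [y] on [t], then [x -> y -> z] along [t] and [c], closed by [b],
    would be a 3-bridge unless [b = c]; in that case [b] would meet [t] twice, against cleanness. *)
Lemma in_rung_uniq t z x b y c :
  clean b t x -> before b x z -> clean c t y -> before c y z -> x = y /\ b = c.
Proof.
have aux u v d e : clean d t u -> before d u z -> clean e t v -> before e v z -> ~~ before t u v.
  move=> dt du et ev; apply/negP => tuv.
  have ed : d = e.
    apply/eqP; apply/negPn/negP => ne.
    have /no_3bridge/(_ tuv ev) : uniq [:: t; e; d].
      by rewrite /= !inE !negb_or (eq_sym t) (clean_neq et) eq_sym (clean_neq dt) eq_sym ne.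
    by rewrite du.
  have vu : v = u by apply: (clean_uniq dt); rewrite ?ed ?(clean_incl et) ?(clean_incr et).
  by move: tuv; rewrite vu => h; exact: (before_asym h h).
move=> bt bx ct cy; have := before_total (clean_incr bt) (clean_incr ct).
rewrite (negbTE (aux _ _ _ _ bt bx ct cy)) (negbTE (aux _ _ _ _ ct cy bt bx)) !orbF => /eqP e.
by split=> //; apply: (no_2bridge bx); rewrite e.
Qed.

(** The mirror image: the 3-bridge to exclude is [z -> x -> y] along [b] and [t], closed by [c]. *)
Lemma out_rung_uniq t z x b y c :
  clean b t x -> before b z x -> clean c t y -> before c z y -> x = y /\ b = c.
Proof.
have aux u v d e : clean d t u -> before d z u -> clean e t v -> before e z v -> ~~ before t u v.
  move=> dt du et ev; apply/negP => tuv.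
  have ed : d = e.
    apply/eqP; apply/negPn/negP => ne.
    have /no_3bridge/(_ du tuv) : uniq [:: d; t; e].
      by rewrite /= !inE !negb_or (eq_sym t) (clean_neq et) (clean_neq dt) ne.
    by rewrite ev.
  have vu : v = u by apply: (clean_uniq dt); rewrite ?ed ?(clean_incl et) ?(clean_incr et).
  by move: tuv; rewrite vu => h; exact: (before_asym h h).
move=> bt bx ct cy; have := before_total (clean_incr bt) (clean_incr ct).
rewrite (negbTE (aux _ _ _ _ bt bx ct cy)) (negbTE (aux _ _ _ _ ct cy bt bx)) !orbF => /eqP e.
by split=> //; apply: (no_2bridge bx); rewrite e.
Qed.

(* Two paths that meet twice do so in opposite orders; two different paths
   returning to the same side of [x] on [a] would then form a 3-bridge with [a]. *)
Lemma card_unclean a x : inc a x -> #|[set b | inc b x && ~~ clean a b x]| <= 3.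
Proof.
move=> ax.
pose F := [set b | (b != a) && [exists z, before a x z && before b z x]].
pose B := [set b | (b != a) && [exists z, before a z x && before b x z]].
have F1 : #|F| <= 1.
  apply/card_le1_eqP => b c; rewrite !inE.
  move=> /andP[ba /existsP[y /andP[axy byx]]] /andP[ca /existsP[z /andP[axz czx]]] /=.
  apply/eqP; apply/negPn/negP => cb; have /and3P[_ ay _] := axy; have /and3P[_ az _] := axz.
  case/or3P: (before_total ay az) => [/eqP e|yz|zy].
  - by move: cb; rewrite (no_2bridge byx (b := c)) ?eqxx ?e.
  - have /no_3bridge/(_ yz czx) : uniq [:: a; c; b].
      by rewrite /= !inE !negb_or eq_sym ca eq_sym ba cb.
    by rewrite byx.
  have /no_3bridge/(_ zy byx) : uniq [:: a; b; c].
    by rewrite /= !inE !negb_or eq_sym ba eq_sym ca eq_sym cb.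
  by rewrite czx.
have B1 : #|B| <= 1.
  apply/card_le1_eqP => b c; rewrite !inE.
  move=> /andP[ba /existsP[y /andP[ayx bxy]]] /andP[ca /existsP[z /andP[azx cxz]]] /=.
  apply/eqP; apply/negPn/negP => cb; have /and3P[ay _ _] := ayx; have /and3P[az _ _] := azx.
  case/or3P: (before_total ay az) => [/eqP e|yz|zy].
  - by move: cb; rewrite (no_2bridge bxy (b := c)) ?eqxx ?e.
  - have /no_3bridge/(_ bxy yz) : uniq [:: b; a; c].
      by rewrite /= !inE !negb_or ba eq_sym cb eq_sym ca.
    by rewrite cxz.
  have /no_3bridge/(_ cxz zy) : uniq [:: c; a; b].
    by rewrite /= !inE !negb_or ca cb eq_sym ba.
  by rewrite bxy.
(* The 3 counts [a] itself, never clean with itself, and at most one path in each of [F] and [B]. *)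
apply: (leq_trans (n := #|[set a] :|: (F :|: B)|)).
  apply/subset_leq_card/subsetP => b; rewrite !inE => /andP[bx].
  case: (b =P a) => //= /eqP ba; rewrite /clean eq_sym ba ax bx /= negb_forall.
  case/existsP => z; rewrite negb_imply => /andP[/andP[az bz] zx].
  case/or3P: (before_total ax az) => [|xz|zx']; first by rewrite eq_sym (negbTE zx).
  - apply/orP; left; apply/existsP; exists z; rewrite xz /=.
    case/or3P: (before_total bx bz) => // [|h]; first by rewrite eq_sym (negbTE zx).
    by rewrite (no_2bridge xz h) eqxx in ba.
  - apply/orP; right; apply/existsP; exists z; rewrite zx' /=.
    case/or3P: (before_total bx bz) => // [|h]; first by rewrite eq_sym (negbTE zx).
    by rewrite (no_2bridge zx' h) eqxx in ba.
by rewrite (leq_trans (leq_card_setU _ _)) // cards1 (leq_trans (n := 1 + (1 + 1))) ?leq_add2l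
     ?(leq_trans (leq_card_setU _ _)) ?leq_add.
Qed.

(** * Rungs between two paths *)

Definition rung s r t y w := [&& clean s t y, clean r t w & before t y w].

Lemma rung_uniq s r t1 t2 y w1 w2 :
  rung s r t1 y w1 -> rung s r t2 y w2 -> t1 = t2 /\ w1 = w2.
Proof.
move=> /and3P[_ r1 b1] /and3P[_ r2 b2]; rewrite cleanC in r1; rewrite cleanC in r2.
by have [] := out_rung_uniq r1 b1 r2 b2.
Qed.

(** Otherwise [y1 -> y2 -> w2 -> w1] along [s], [t2], [r], closed by [t1], would be a 4-bridge.
    Cleanness makes the four paths distinct, and [in_rung_uniq] rules out [w1 = w2]. *)
Lemma rung_mono s r t1 y1 w1 t2 y2 w2 :
  rung s r t1 y1 w1 -> rung s r t2 y2 w2 -> before s y1 y2 -> before r w1 w2.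
Proof.
move=> /and3P[s1 r1 b1] /and3P[s2 r2 b2] sy.
have ny : y1 <> y2 by move=> e; move: sy; rewrite e => h; exact: (before_asym h h).
have nt : t1 != t2.
  apply/eqP => e; apply: ny; apply/esym/(clean_uniq s1); first exact: clean_incl s2.
  by rewrite e (clean_incr s2).
case/or3P: (before_total (clean_incl r1) (clean_incl r2)) => [/eqP e||rw] //.
  rewrite cleanC in s1; rewrite cleanC in s2; rewrite -e in b2.
  by case: (in_rung_uniq s1 b1 s2 b2).
have sr : s != r.
  apply/eqP => e; rewrite -e in r1; have := clean_uniq s1 (clean_incl r1) (clean_incr r1).
  by move=> e'; move: b1; rewrite e' => h; exact: (before_asym h h).
have /no_4bridge/(_ sy b2 rw) : uniq [:: s; t2; r; t1].
  rewrite /= !inE !negb_or (clean_neq s2) sr (clean_neq s1) (clean_neq r1) eq_sym (clean_neq r2).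
  by rewrite eq_sym nt.
by rewrite b1.
Qed.


Variables (len : P -> nat) (D : nat).
Hypothesis pos_len : forall a x, inc a x -> pos a x < len a.
(** Exact regularity will come from splitting nodes into copies. Some copies lie on no path at all;
    the premise exempts them. *)
Hypothesis deg : forall a x, inc a x -> #|[set b | inc b x]| = D.

(** Cutting into blocks of [k] positions, instead of bounding a distance, makes nearness an
    equivalence relation, so that Cauchy-Schwarz applies to the block numbers. *)
Definition near k a x y := pos a x %/ k == pos a y %/ k.
Lemma nearC k a x y : near k a x y = near k a y x. Proof. exact: eq_sym. Qed.

Definition star x := [set b | inc b x].
Definition block k a x := [set y | inc a y && near k a x y].
Definition incs := [set i : P * V | inc i.1 i.2].

Lemma card_block k a x : 0 < k -> #|block k a x| <= k.
Proof.
move=> k0; rewrite cardE -(size_map (pos a)) -[k in X in _ <= X](size_iota (pos a x %/ k * k)).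
apply: uniq_leq_size.
  rewrite map_inj_in_uniq ?enum_uniq // => y z; rewrite !mem_enum !inE.
  by move=> /andP[ay _] /andP[az _]; apply: pos_inj.
move=> i /mapP[y]; rewrite mem_enum inE => /andP[_ /eqP e] ->.
by rewrite mem_iota e leq_divM /= -mulSnr ltn_ceil.
Qed.

Lemma card_clean t y : inc t y -> D - 3 <= #|[set a | clean a t y]|.
Proof.
move=> ty; rewrite -(deg ty) leq_subLR addnC.
apply: leq_trans (leq_add (leqnn _) (card_unclean ty)).
rewrite -(cardsID [set a | clean a t y]); apply: leq_add; apply/subset_leq_card/subsetP => a.
  by rewrite !inE => /andP[].
by rewrite !inE cleanC andbC.
Qed.

Local Notation rungT := (P * P * (P * V * V))%type.

Section Edges.
Variables (m : nat) (m_gt0 : 0 < m).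

(* Edges longer than a block are not counted, so no bound on the lengths of the paths is needed. *)
Definition edges := [set e : P * V * V | before e.1.1 e.1.2 e.2 && near m e.1.1 e.1.2 e.2].

Lemma card_edges_le : #|edges| <= #|incs| * m.
Proof.
apply: leq_trans (leq_card_dep (G := fun i => block m i.1 i.2) _) => [|[a x] _]; last exact: card_block.
by apply/subset_leq_card/subsetP => -[[a x] y]; rewrite !inE /= => /andP[/and3P[-> -> _] ->].
Qed.

(** Cauchy-Schwarz for the map from an incidence to its path and block number: two incidences in one
    block are equal or form an edge, read in one of two directions. *)
Lemma card_edges_ge :
  #|incs| ^ 2 <= (\sum_a (len a %/ m).+1) * (#|incs| + 2 * #|edges|).
Proof.
pose N := (\sum_a len a).+1.
pose f (i : P * V) : P * 'I_N := (i.1, inord (pos i.1 i.2 %/ m)).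
pose A0 := [set ak : P * 'I_N | ak.2 < (len ak.1 %/ m).+1].
have fN a x : inc a x -> pos a x %/ m < N.
  move=> ax; rewrite ltnS (leq_trans (leq_div _ _)) // (bigD1 a) //= ltnW //.
  by rewrite (leq_trans (pos_len ax)) ?leq_addr.
have fA : {in incs, forall i, f i \in A0}.
  by move=> [a x]; rewrite !inE /= => ax; rewrite inordK ?fN // ltnS leq_div2r // ltnW ?pos_len.
apply: leq_trans (sqr_card_leq_collisions fA) _; apply: leq_mul; first exact: card_bounded_keys.
pose dg (i : P * V) := (i, i).
pose up (e : P * V * V) := ((e.1.1, e.1.2), (e.1.1, e.2)).
pose dn (e : P * V * V) := ((e.1.1, e.2), (e.1.1, e.1.2)).
apply: (leq_trans (n := #|dg @: incs :|: (up @: edges :|: dn @: edges)|)); last first.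
  rewrite (leq_trans (leq_card_setU _ _)) // leq_add ?leq_imset_card //.
  by rewrite (leq_trans (leq_card_setU _ _)) // mul2n -addnn leq_add ?leq_imset_card.
apply/subset_leq_card/subsetP => -[[a x] [b y]]; rewrite !inE /=.
move=> /and3P[ax by' /eqP[ab /(congr1 val)]]; subst b; rewrite /= !inordK ?fN // => xy.
apply/orP; case/or3P: (before_total ax by') => [/eqP <-|h|h].
- by left; apply/imsetP; exists (a, x) => //; rewrite inE.
- by right; apply/orP; left; apply/imsetP; exists (a, x, y) => //; rewrite inE /= h /near xy eqxx.
by right; apply/orP; right; apply/imsetP; exists (a, y, x) => //; rewrite inE /= h /near xy eqxx.
Qed.

Definition rungs :=
  [set q : rungT |
     let: (s, r, (t, y, w)) := q in ((t, y, w) \in edges) && rung s r t y w].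

(** Over an edge of [t], the paths [s] and [r] are chosen independently among the at least [D - 3]
    paths crossing [t] cleanly at either end. *)
Lemma card_rungs_ge : #|edges| * (D - 3) ^ 2 <= #|rungs|.
Proof.
apply: (geq_card_fibers (f := snd)) => -[[t y] w] e.
have /andP[/and3P[ty tw lt] nr] : before t y w && near m t y w by rewrite inE in e.
pose A := setX [set a | clean a t y] [set a | clean a t w].
pose h (sr : P * P) := (sr, (t, y, w)).
apply: (leq_trans (n := #|h @: A|)).
  rewrite card_imset ?cardsX => [|u v [] //].
  by rewrite -mulnn leq_mul ?card_clean.
apply/subset_leq_card/subsetP => q /imsetP[[s r]]; rewrite !inE /= => /andP[cs cr] ->.
by rewrite /= eqxx e /rung cs cr /before ty tw lt.
Qed.

(** * Quads: pairs of close rungs *)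

Section Quads.
Variables (k : nat) (k_gt0 : 0 < k).

(** Two routes from [y] to [w']: along [s] to [y'] and then [t'], or along [t] to [w] and then
    [r]. *)
Definition quads :=
  [set q : rungT * rungT |
    let: ((s, r, (t, y, w)), (s', r', (t', y', w'))) := q in
    [&& (s, r, (t, y, w)) \in rungs, (s', r', (t', y', w')) \in rungs, s == s', r == r',
        before s y y', before r w w', near k s y y' & near k r w w']].

(* By monotonicity, two rungs between [s] and [r] with the same sum of block
   numbers lie in the same block of [s] and in the same block of [r]. *)
Lemma card_rungs_le :
  #|rungs| <= #|quads| + \sum_(ab : P * P) (len ab.1 %/ k + len ab.2 %/ k).+1.
Proof.
(* Rungs that are second in some quad number at most [#|quads|]; the others are shown to have
   distinct keys. *)
rewrite -(cardsID (snd @: quads) rungs); apply: leq_add.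
  by rewrite (leq_trans (subset_leq_card (subsetIr _ _))) ?leq_imset_card.
pose N := (2 * \sum_a len a).+1.
have lenN a x : inc a x -> pos a x %/ k <= \sum_a len a.
  move=> ax; rewrite (leq_trans (leq_div _ _)) // (bigD1 a) //= ltnW //.
  by rewrite (leq_trans (pos_len ax)) ?leq_addr.
pose key (q : rungT) :=
  let: (s, r, (t, y, w)) := q in pos s y %/ k + pos r w %/ k.
pose f (q : rungT) : P * P * 'I_N := (q.1, inord (key q)).
have keyN q : q \in rungs -> key q < N.
  move: q => [[s r] [[t y] w]]; rewrite inE => /andP[_ /and3P[sy rw _]].
  by rewrite ltnS mul2n -addnn leq_add ?lenN ?(clean_incl sy) ?(clean_incl rw).
have aux s r t1 y1 w1 t2 y2 w2 :
    (s, r, (t1, y1, w1)) \in rungs -> (s, r, (t2, y2, w2)) \in rungs :\: (snd @: quads) ->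
    key (s, r, (t1, y1, w1)) = key (s, r, (t2, y2, w2)) -> ~~ before s y1 y2.
  move=> R1; rewrite inE => /andP[/negP nq R2] ek; apply/negP => sy; apply: nq.
  have G1 : rung s r t1 y1 w1 by move: R1; rewrite inE => /andP[].
  have G2 : rung s r t2 y2 w2 by move: R2; rewrite inE => /andP[].
  have rw := rung_mono G1 G2 sy.
  apply/imsetP; exists ((s, r, (t1, y1, w1)), (s, r, (t2, y2, w2))) => //.
  rewrite inE R1 R2 !eqxx sy rw /near /=; move: ek => /=.
  have /and3P[_ _ /ltnW/(leq_div2r k)] := sy; have /and3P[_ _ /ltnW/(leq_div2r k)] := rw.
  by move=> ? ? ?; apply/andP; split; apply/eqP; lia.
have inj : {in rungs :\: (snd @: quads) &, injective f}.
  move=> [[s r] [[t1 y1] w1]] [[s' r'] [[t2 y2] w2]] M1 M2.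
  have R1 : (s, r, (t1, y1, w1)) \in rungs by move: M1; rewrite inE => /andP[].
  have R2 : (s', r', (t2, y2, w2)) \in rungs by move: M2; rewrite inE => /andP[].
  case=> es er /(congr1 val) /=; subst s' r'.
  rewrite !inordK; [|exact: (keyN _ R2)|exact: (keyN _ R1)] => ek.
  have /and3P[c1 _ _] : rung s r t1 y1 w1 by move: R1; rewrite inE => /andP[].
  have /and3P[c2 _ _] : rung s r t2 y2 w2 by move: R2; rewrite inE => /andP[].
  have := before_total (clean_incl c1) (clean_incl c2).
  rewrite (negbTE (aux _ _ _ _ _ _ _ _ R1 M2 ek)) (negbTE (aux _ _ _ _ _ _ _ _ R2 M1 (esym ek))).
  rewrite !orbF => /eqP e; subst y2.
  move: R1 R2; rewrite !inE => /andP[_ G1] /andP[_ G2].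
  by have [-> ->] := rung_uniq G1 G2.
rewrite -(card_in_imset inj).
apply: leq_trans (card_bounded_keys (fun ab : P * P => (len ab.1 %/ k + len ab.2 %/ k).+1) N).
apply/subset_leq_card/subsetP => _ /imsetP[[[s r] [[t y] w]] M ->].
have R : (s, r, (t, y, w)) \in rungs by move: M; rewrite inE => /andP[].
rewrite inE /= inordK; last exact: keyN R.
move: R; rewrite inE => /andP[_ /and3P[sy rw _]].
by rewrite ltnS leq_add // leq_div2r // ltnW // pos_len ?(clean_incl sy) ?(clean_incl rw).
Qed.

Lemma quadP s r t y w s' r' t' y' w' :
  ((s, r, (t, y, w)), (s', r', (t', y', w'))) \in quads ->
  [/\ s' = s, r' = r, (t', y', w') \in edges &
   [/\ clean s t y, clean r t w, before t y w, clean s t' y' & clean r t' w'] /\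
   [/\ before t' y' w', before s y y', before r w w', near k s y y' & near k r w w']].
Proof.
rewrite inE => /and5P[R1 R2 /eqP es /eqP er /and4P[? ? ? ?]]; subst s' r'; move: R1 R2.
rewrite 2![_ \in rungs]inE => /andP[_ /and3P[? ? ?]] /andP[? /and3P[? ? ?]].
by do !split.
Qed.

(** The triple [(y, y', w')] together with the paths [s] and [t'], which it determines since there
    is no 2-bridge; recording them makes bases easy to count. *)
Definition base (q : rungT * rungT) : (P * V * V) * P * V :=
  let: ((s, r, (t, y, w)), (s', r', e')) := q in (e', s, y).

Definition bases :=
  [set b : (P * V * V) * P * V |
     (b.1 \in [set c : (P * V * V) * P | (c.1 \in edges) && (c.2 \in star c.1.1.2)]) &&
     (b.2 \in block k b.1.2 b.1.1.1.2)].

Lemma card_bases : #|bases| <= #|edges| * D * k.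
Proof.
apply: leq_trans (@leq_card_dep _ _ _ (fun c => block k c.2 c.1.1.2) k _) _ => [c _|].
  exact: card_block.
rewrite leq_mul2r; apply/orP; right; apply: (leq_card_dep (G := fun e => star e.1.2)) => -[[t y] w].
by rewrite inE => /andP[/and3P[ty _ _] _]; rewrite (deg ty).
Qed.

Lemma base_quads : {in quads, forall q, base q \in bases}.
Proof.
move=> [[[s r] [[t y] w]] [[s' r'] [[t' y'] w']]].
case/quadP => _ _ e [[c1 _ _ c2 _] [_ sy _ nr _]].
by rewrite inE /= inE /= e !inE /= (clean_incl c1) (clean_incl c2) nearC.
Qed.

(* On a fixed base, a quad is determined by the path [t] of its first rung. *)
Lemma quad_base_inj s r t y w s' r' e' s1 r1 w1 y1 s1' r1' e1' :
  ((s, r, (t, y, w)), (s', r', e')) \in quads ->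
  ((s1, r1, (t, y1, w1)), (s1', r1', e1')) \in quads ->
  base ((s, r, (t, y, w)), (s', r', e')) = base ((s1, r1, (t, y1, w1)), (s1', r1', e1')) ->
  ((s, r, (t, y, w)), (s', r', e')) = ((s1, r1, (t, y1, w1)), (s1', r1', e1')).
Proof.
move: e' e1' => [[t' y'] w'] [[t1' y1'] w1'].
case/quadP => -> -> _ [[_ c1 _ _ _] [_ _ b1 _ _]].
case/quadP => -> -> _ [[_ c2 _ _ _] [_ _ b2 _ _]] [-> -> e -> ->].
by rewrite -e in b2; have [-> ->] := in_rung_uniq c1 b1 c2 b2; rewrite e.
Qed.

Definition middle (q : rungT * rungT) := q.1.2.1.1.
Definition source (q : rungT * rungT) := q.1.2.1.2.

Definition quad_pairs :=
  [set qq | [&& qq.1 \in quads, qq.2 \in quads & base qq.1 == base qq.2]].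

Definition clean_quad_pairs :=
  [set qq in quad_pairs | clean (middle qq.1) (middle qq.2) (source qq.1)].

(** Given the first quad, the second is determined by its path [t], which in an unclean pair is one
    of the at most 3 paths through [y] not crossing the first [t] cleanly there. *)
Lemma card_quad_pairs : #|quad_pairs| <= #|clean_quad_pairs| + #|quads| * 3.
Proof.
rewrite -(cardsID clean_quad_pairs); apply: leq_add; first exact/subset_leq_card/subsetIr.
pose G q := [set b | inc b (source q) && ~~ clean (middle q) b (source q)].
apply: (@leq_card_choice _ _ fst _ _ _ _ (middle \o snd) G) => /=.
- by move=> [q1 q2]; rewrite inE => /andP[_]; rewrite inE => /and3P[].
- move=> [q1 q2]; rewrite inE => /andP[ncl]; move=> h; move: (h) ncl.
  rewrite inE /= => /and3P[Q1 Q2 /eqP eb]; rewrite inE h /= => ncl.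
  rewrite inE ncl andbT; move: q1 q2 Q1 Q2 eb {ncl h}.
  move=> [[[s r] [[t y] w]] [[s' r'] [[t' y'] w']]] [[[s1 r1] [[t1 y1] w1]] [[s1' r1'] [[t1' y1'] w1']]].
  move=> _ /quadP[_ _ _ [[c1 _ _ _ _] _]] [_ _ _ _ ->].
  exact: clean_incr c1.
- move=> [q1 q2] [q3 q4]; rewrite inE => /andP[_]; rewrite inE => /and3P[/= _ Q2 /eqP eb].
  rewrite inE => /andP[_]; rewrite inE => /and3P[/= _ Q4 /eqP eb'] e em; subst q3.
  congr pair; rewrite eb in eb'; move: q2 q4 Q2 Q4 em eb' {eb}.
  move=> [[[s r] [[t y] w]] [[s' r'] e']] [[[s1 r1] [[t1 y1] w1]] [[s1' r1'] e1']].
  rewrite /middle /= => Q2 Q4 et eb; subst t1; exact: quad_base_inj eb.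
move=> [[[s r] [[t y] w]] [[s' r'] [[t' y'] w']]] /quadP[_ _ _ [[c1 _ _ _ _] _]].
apply: card_unclean; exact: clean_incr c1.
Qed.

(* A pair of quads [y -> w1 -> w'], [y -> w2 -> w'] over the base [y -> y' -> w']
   is determined by [w1], [w2], [w'] and the paths through them: a path through
   [w1] meets the in-neighbours of [w2] only once, and a path through [w'] meets
   the out-neighbours of [y] only once. *)
Lemma card_clean_quad_pairs : #|clean_quad_pairs| <= #|incs| * k * D * k * D * D.
Proof.
(* The choices, in order: an incidence [(r1, w')], then [w1] in its block, [r2] through [w'], [w2]
   in the block of [w'] on [r2], [t1] through [w1], and [t'] through [w']. *)
pose Y1 := [set x : P * V * V | (x.1 \in incs) && (x.2 \in block k x.1.1 x.1.2)].
pose Y2 := [set x : P * V * V * P | (x.1 \in Y1) && (x.2 \in star x.1.1.2)].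
pose Y3 := [set x : P * V * V * P * V | (x.1 \in Y2) && (x.2 \in block k x.1.2 x.1.1.1.2)].
pose Y4 := [set x : P * V * V * P * V * P | (x.1 \in Y3) && (x.2 \in star x.1.1.1.2)].
pose Y5 := [set x : P * V * V * P * V * P * P | (x.1 \in Y4) && (x.2 \in star x.1.1.1.1.1.2)].
have cY5 : #|Y5| <= #|incs| * k * D * k * D * D.
  have inY1 r w z : (r, w, z) \in Y1 -> inc r w /\ inc r z.
    by rewrite !inE /= => /and3P[].
  apply: leq_trans (@leq_card_dep _ _ _ (fun x => star x.1.1.1.1.2) D _) _ => [[[[[[r w] z] r2] z2] t]|].
    rewrite inE /= => /andP[]; rewrite inE /= => /andP[]; rewrite inE /= => /andP[/inY1[rw _] _] _ _.
    by rewrite (deg rw).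
  rewrite leq_mul2r; apply/orP; right.
  apply: leq_trans (@leq_card_dep _ _ _ (fun x => star x.1.1.2) D _) _ => [[[[[r w] z] r2] z2]|].
    rewrite inE /= => /andP[]; rewrite inE /= => /andP[/inY1[_ rz] _] _.
    by rewrite (deg rz).
  rewrite leq_mul2r; apply/orP; right.
  apply: leq_trans (@leq_card_dep _ _ _ (fun x => block k x.2 x.1.1.2) k _) _ => [x _|].
    exact: card_block.
  rewrite leq_mul2r; apply/orP; right.
  apply: leq_trans (@leq_card_dep _ _ _ (fun x => star x.1.2) D _) _ => [[[r w] z] /inY1[rw _]|].
    by rewrite (deg rw).
  rewrite leq_mul2r; apply/orP; right.
  by apply: (leq_card_dep (G := fun i => block k i.1 i.2)) => x _; apply: card_block.
apply: leq_trans cY5.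
pose F (qq : (rungT * rungT) * (rungT * rungT)) :=
  let: (((_, r1, (t1, _, w1)), (_, _, (t', _, w'))), ((_, r2, (_, _, w2)), _)) := qq in
  (r1, w', w1, r2, w2, t1, t').
have inj : {in clean_quad_pairs &, injective F}.
  move=> [[[[s r1] [[t1 y] w1]] [[s' r1'] [[t' y'] w']]]
  [[[ss r2] [[t2 yy] w2]] [[ss' r2'] [[tt' yy'] ww']]]].
  move=> [[[[as_ ar1] [[at1 ay] aw1]] [[as' ar1'] [[at' ay'] aw']]]
           [[[ass ar2] [[at2 ayy] aw2]] [[ass' ar2'] [[att' ayy'] aww']]]].
  rewrite inE => /andP[]; rewrite inE => /and3P[/quadP[? ? _ [[_ _ _ c2 _] [_ b2 _ _ _]]]].
  move=> /quadP[? ? _ [[_ _ b1 _ _] _]] /eqP[? ? ? ? ?]; subst; rewrite /middle /source /= => c1.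
  rewrite inE => /andP[]; rewrite inE => /and3P[/quadP[? ? _ [[_ _ _ d2 _] [_ e2 _ _ _]]]].
  move=> /quadP[? ? _ [[_ _ e1 _ _] _]] /eqP[? ? ? ? ?]; subst; rewrite /middle /source /= => d1.
  rewrite /F => -[*]; subst.
  rewrite cleanC in c1; rewrite cleanC in d1.
  have [? ?] := in_rung_uniq c1 b1 d1 e1; subst.
  by have [? ?] := out_rung_uniq c2 b2 d2 e2; subst.
rewrite -(card_in_imset inj); apply/subset_leq_card/subsetP => _ /imsetP[qq Q ->].
move: qq Q => [[[[s r1] [[t1 y] w1]] [[s' r1'] [[t' y'] w']]]
  [[[ss r2] [[t2 yy] w2]] [[ss' r2'] [[tt' yy'] ww']]]].
rewrite inE => /andP[]; rewrite inE => /and3P[/quadP[? ? _ [[_ c1 _ _ c2] [_ _ b1 _ n1]]]].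
move=> /quadP[? ? _ [[_ d1 _ _ d2] [_ _ e1 _ o1]]] /eqP[? ? ? ? ?] _; subst.
have inc_r2 := clean_incl d2; rewrite nearC in n1; rewrite nearC in o1.
rewrite /Y5 /Y4 /Y3 /Y2 /Y1 /star /block !inE /= (clean_incl c2) (clean_incl c1) (clean_incr c1).
by rewrite (clean_incr c2) (clean_incl d1) inc_r2 n1 o1.
Qed.

Lemma quads_bound :
  #|quads| ^ 2 <= #|incs| * m * D * k * (#|incs| * k ^ 2 * D ^ 3 + 3 * #|quads|).
Proof.
apply: leq_trans (sqr_card_leq_collisions base_quads) _; apply: leq_mul.
  by apply: leq_trans card_bases _; rewrite !leq_mul // card_edges_le.
apply: leq_trans card_quad_pairs _; rewrite mulnC leq_add2r.
by apply: leq_trans card_clean_quad_pairs _; apply: eq_leq; lia.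
Qed.

End Quads.
End Edges.
End BridgeFree.

(** * Splitting the nodes of a path system *)

Lemma precedes_neq (T : eqType) (s : seq T) x y : precedes s x y -> x != y.
Proof. by case/and3P => _ _ h; apply/eqP => e; rewrite e ltnn in h. Qed.

Section SplitSystem.
Variables (n : nat) (Q : seq (seq 'I_n)).
Hypothesis Q_uniq : all uniq Q.
Hypothesis Q_girth : bridge_girth_gt Q 4.

Local Notation path a := (nth [::] Q (a : 'I_(size Q))).

Lemma bridge_of_seqs x0 (vs : seq 'I_n) (ps : seq 'I_(size Q)) b :
  1 < b -> size vs = b -> size ps = b -> uniq vs -> uniq ps ->
  (forall i, i.+1 < b -> precedes (nth [::] Q (nth 0 (map val ps) i)) (nth x0 vs i) (nth x0 vs i.+1)) ->
  precedes (nth [::] Q (nth 0 (map val ps) b.-1)) (nth x0 vs 0) (nth x0 vs b.-1) ->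
  has_bridge Q b.
Proof.
move=> b1 sv sp uv up h1 h2; split; first exact: ltnW.
exists (nth x0 vs), (nth 0 (map val ps)); split; last split; last split=> //.
- move=> i j ib jb /eqP; rewrite nth_uniq ?sv //; by move/eqP.
- move=> i j ib jb /eqP; rewrite nth_uniq ?size_map ?sp ?map_inj_uniq //; first by move/eqP.
  exact: val_inj.
move=> i ib; have /(mem_nth 0) : i < size (map val ps) by rewrite size_map sp.
by case/mapP => a _ ->; apply: ltn_ord.
Qed.

Lemma raw_no_2bridge a b x y : precedes (path a) x y -> precedes (path b) x y -> a = b.
Proof.
move=> h1 h2; apply/eqP; apply/negPn/negP => ab; apply: (@Q_girth 2) => //.
apply: (@bridge_of_seqs x [:: x; y] [:: a; b]) => //=; rewrite ?inE ?andbT ?ab ?(precedes_neq h1) //.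
by case.
Qed.

Lemma raw_no_3bridge a b c x y z : uniq [:: a; b; c] ->
  precedes (path a) x y -> precedes (path b) y z -> ~~ precedes (path c) x z.
Proof.
move=> u h1 h2; apply/negP => h3; apply: (@Q_girth 3) => //.
apply: (@bridge_of_seqs x [:: x; y; z] [:: a; b; c]) => //; last by case=> [|[]].
by rewrite /= !inE negb_or (precedes_neq h1) (precedes_neq h2) (precedes_neq h3).
Qed.

Lemma raw_no_4bridge a b c d x y z w : uniq [:: a; b; c; d] ->
  precedes (path a) x y -> precedes (path b) y z -> precedes (path c) z w ->
  ~~ precedes (path d) x w.
Proof.
move=> u h1 h2 h3; apply/negP => h4.
(* A bridge needs all nodes distinct. Equality of two opposite nodes would leave a 2-bridge: [c],
   [d] if [x = z], and [a], [d] if [y = w]. *)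
have xz : x != z.
  by apply: contraL u => /eqP e; rewrite (raw_no_2bridge h3 (b := d)) -?e //= !inE eqxx !andbF.
have yw : y != w.
  by apply: contraL u => /eqP e; rewrite (raw_no_2bridge h1 (b := d)) ?e //= !inE eqxx !orbT.
apply: (@Q_girth 4) => //.
apply: (@bridge_of_seqs x [:: x; y; z; w] [:: a; b; c; d]) => //; last by case=> [|[|[]]].
by rewrite /= !inE !negb_or (precedes_neq h1) (precedes_neq h2) (precedes_neq h3) (precedes_neq h4) xz yw.
Qed.

Variables (D : nat) (D_gt0 : 0 < D).

Definition paths_at (v : 'I_n) := [seq a <- enum 'I_(size Q) | v \in path a].

Lemma mem_paths_at v a : (a \in paths_at v) = (v \in path a).
Proof. by rewrite mem_filter mem_enum andbT. Qed.

Lemma paths_at_uniq v : uniq (paths_at v).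
Proof. by rewrite filter_uniq ?enum_uniq. Qed.

(* A node is split into copies indexed by blocks of [D] consecutive paths
   through it; a last incomplete block is discarded. *)
Definition split_inc (a : 'I_(size Q)) (x : 'I_n * 'I_(size Q)) :=
  [&& x.1 \in path a, index a (paths_at x.1) %/ D == x.2 & x.2.+1 * D <= size (paths_at x.1)].

Definition split_pos (a : 'I_(size Q)) (x : 'I_n * 'I_(size Q)) := index x.1 (path a).

Local Notation sbefore := (before split_inc split_pos).

Lemma split_before a x y : sbefore a x y -> precedes (path a) x.1 y.1.
Proof. by case/and3P => /and3P[xa _ _] /and3P[ya _ _] h; apply/and3P. Qed.

(** A path keeps at most one copy of each of its nodes, since its index determines the block. *)
Lemma split_pos_inj a x y :
  split_inc a x -> split_inc a y -> split_pos a x = split_pos a y -> x = y.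
Proof.
move: x y => [v i] [w j] /and3P[/= va /eqP vi _] /and3P[/= wa /eqP wj _] e.
have vw : v = w by rewrite -(nth_index v va) -(nth_index v wa) [index v _]e.
by subst w; congr pair; apply: val_inj; rewrite /= -vi wj.
Qed.

Lemma split_no_2bridge a b x y : sbefore a x y -> sbefore b x y -> a = b.
Proof. by move=> /split_before h /split_before; apply: raw_no_2bridge. Qed.

Lemma split_no_3bridge a b c x y z : uniq [:: a; b; c] ->
  sbefore a x y -> sbefore b y z -> ~~ sbefore c x z.
Proof.
move=> u /split_before h1 /split_before h2.
by apply: contra (raw_no_3bridge u h1 h2); apply: split_before.
Qed.

Lemma split_no_4bridge a b c d x y z w : uniq [:: a; b; c; d] ->
  sbefore a x y -> sbefore b y z -> sbefore c z w -> ~~ sbefore d x w.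
Proof.
move=> u /split_before h1 /split_before h2 /split_before h3.
by apply: contra (raw_no_4bridge u h1 h2 h3); apply: split_before.
Qed.

Lemma split_pos_len a x : split_inc a x -> split_pos a x < size (path a).
Proof. by case/and3P; rewrite index_mem. Qed.

Lemma split_deg a x : split_inc a x -> #|[set b | split_inc b x]| = D.
Proof.
move: x => [v j] /and3P[/= _ _ full]; set s := paths_at v.
pose t := map (nth a s) (iota (j * D) D).
have lt i : i \in iota (j * D) D -> i < size s.
  by rewrite mem_iota => /andP[_ h]; rewrite (leq_trans h) // -mulSnr.
have ut : uniq t.
  rewrite map_inj_in_uniq ?iota_uniq // => i k /lt ls /lt ks /eqP.
  by rewrite nth_uniq ?paths_at_uniq // => /eqP.
rewrite -[RHS](size_iota (j * D)) -(size_map (nth a s)) -(card_uniqP ut).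
apply: eq_card => b; rewrite inE /split_inc /= full andbT -mem_paths_at -/s.
apply/andP/mapP => [[bs /eqP e]|[i ii ->]].
  exists (index b s); last by rewrite nth_index.
  by rewrite mem_iota -e leq_divM /= -mulSnr ltn_ceil.
have is' := lt _ ii; rewrite mem_nth // index_uniq ?paths_at_uniq //; split=> //.
move: ii; rewrite mem_iota => /andP[l1 l2]; rewrite eqn_leq -ltnS ltn_divLR // mulSnr l2 /=.
by rewrite leq_divRL.
Qed.

(** * Counting incidences before and after splitting *)

Lemma ps_sizeE : ps_size Q = \sum_(a < size Q) size (path a).
Proof. by rewrite /ps_size sumnE big_map (big_nth [::]) big_mkord. Qed.

Lemma card_path_incs : #|[set i : 'I_(size Q) * 'I_n | i.2 \in path i.1]| = ps_size Q.
Proof.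
rewrite ps_sizeE (@card_fibers _ _ fst _ setT) => [|x _]; last by rewrite inE.
apply: eq_big => [a|a _]; first by rewrite inE.
have ua : uniq (path a) by apply: (allP Q_uniq); rewrite mem_nth.
have pi : injective (pair a : 'I_n -> 'I_(size Q) * 'I_n) by move=> x y [].
rewrite -(card_uniqP ua) -(card_imset _ pi).
apply: eq_card => -[b v]; rewrite !inE /=; apply/andP/imsetP => [[vb /eqP e]|[w wa [-> ->]]] //.
by exists v; rewrite -?e.
Qed.

(** Only incomplete last blocks are lost. A lost incidence is determined by its node and its index
    modulo [D], because the quotient must be that of the last block. *)
Lemma card_split_incs : ps_size Q <= #|incs split_inc| + n * D.
Proof.
pose All := [set i : 'I_(size Q) * 'I_n | i.2 \in path i.1].
pose ix (i : 'I_(size Q) * 'I_n) := index i.1 (paths_at i.2).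
pose Bad := [set i in All | size (paths_at i.2) < (ix i %/ D).+1 * D].
have ixL i : i \in All -> ix i < size (paths_at i.2).
  by rewrite inE => h; rewrite index_mem mem_paths_at.
have cBad : #|Bad| <= n * D.
  have cn : #|[set: 'I_n]| = n by rewrite cardsT card_ord.
  apply: leq_trans (_ : #|[set: 'I_n]| * D <= _); last by rewrite cn.
  apply: (@leq_card_choice _ _ snd _ _ _ _ (fun i => inord (ix i %% D) : 'I_D.-1.+1) (fun=> setT)).
  - by move=> x _; rewrite inE.
  - by move=> x _; rewrite inE.
  - move=> [a v] [b w]; rewrite inE => /andP[Aa Ba]; rewrite inE => /andP[Ab Bb] /= vw; subst w.
    move/(congr1 val); rewrite /= !inordK ?prednK ?ltn_mod // => e.
    have d i : i \in All -> size (paths_at i.2) < (ix i %/ D).+1 * D ->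
        ix i %/ D = size (paths_at i.2) %/ D.
      move=> Ai Bi; apply/eqP; rewrite eqn_leq leq_div2r ?(ltnW (ixL _ Ai)) //=.
      by rewrite -ltnS ltn_divLR.
    have : ix (a, v) = ix (b, v).
      by rewrite (divn_eq (ix (a, v)) D) (divn_eq (ix (b, v)) D) e (d _ Aa Ba) (d _ Ab Bb).
    move=> eix; congr pair; rewrite inE -mem_paths_at /= in Aa; rewrite inE -mem_paths_at /= in Ab.
    by rewrite -(nth_index a Aa) -(nth_index a Ab) [index a _]eix.
  by move=> v _; rewrite cardsT card_ord prednK.
rewrite -card_path_incs -/All -(cardsID Bad All) addnC; apply: leq_add; last first.
  by apply: leq_trans cBad; apply/subset_leq_card/subsetIr.
(* The default [i.1] of [insubd] is never taken: the block number is below [size Q], as [lt]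
   shows. *)
pose g (i : 'I_(size Q) * 'I_n) : 'I_(size Q) * ('I_n * 'I_(size Q)) :=
  (i.1, (i.2, insubd i.1 (ix i %/ D))).
have gi : injective g by move=> [a v] [b w] [-> ->].
rewrite -(card_imset _ gi); apply/subset_leq_card/subsetP => _ /imsetP[[a v] h ->].
move: h; rewrite !inE /= => /andP[]; rewrite negb_and => nb va; rewrite va /= -leqNgt in nb.
have lt : ix (a, v) %/ D < size Q.
  apply: leq_ltn_trans (leq_div _ _) _; apply: leq_trans (ixL _ _) _; first by rewrite inE.
  by rewrite size_filter (leq_trans (count_size _ _)) // size_enum_ord.
by rewrite /split_inc /= va val_insubd lt eqxx.
Qed.

Lemma card_split_incs_le : #|incs split_inc| <= ps_size Q.
Proof.
pose g (i : 'I_(size Q) * ('I_n * 'I_(size Q))) := (i.1, i.2.1).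
have gi : {in incs split_inc &, injective g}.
  move=> [a [v i]] [b [w j]]; rewrite !inE /= => ha hb [ab vw]; subst b w.
  by congr pair; apply: split_pos_inj ha hb _.
rewrite -(card_in_imset gi) -card_path_incs.
apply/subset_leq_card/subsetP => _ /imsetP[[a [v i]] h ->].
by move: h; rewrite !inE /= => /and3P[].
Qed.

Lemma sum_divn_le (I : finType) (F : I -> nat) k :
  (\sum_i (F i %/ k).+1) * k <= #|I| * k + \sum_i F i.
Proof.
rewrite big_distrl /= -sum_nat_const -big_split /=; apply: leq_sum => i _.
by rewrite mulSnr addnC leq_add2l leq_divM.
Qed.

(** [I], [B], [E], [R], [T], [K] count or bound incidences, blocks, edges, rungs, quads and rung
    keys. The block length [k] comes last because it will be chosen in terms of [R]. *)
Lemma counting_inequalities m : 0 < m -> exists I B E R,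
  [/\ ps_size Q <= I + n * D, I <= ps_size Q, I ^ 2 <= B * (I + 2 * E),
      B * m <= size Q * m + ps_size Q & E * (D - 3) ^ 2 <= R] /\
  forall k, 0 < k -> exists T K,
  [/\ R <= T + K, K * k <= size Q ^ 2 * k + 2 * (size Q * ps_size Q) &
      T ^ 2 <= I * m * D * k * (I * k ^ 2 * D ^ 3 + 3 * T)].
Proof.
move=> m0; pose len (a : 'I_(size Q)) := size (path a).
exists #|incs split_inc|, (\sum_a (len a %/ m).+1), #|edges split_inc split_pos m|,
  #|rungs split_inc split_pos m|.
split=> [|k k0]; first split.
- exact: card_split_incs.
- exact: card_split_incs_le.
- exact: (card_edges_ge split_pos_inj split_pos_len).
- by rewrite ps_sizeE (leq_trans (sum_divn_le _ _)) // card_ord.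
- exact: (card_rungs_ge split_pos_inj split_no_2bridge split_no_3bridge split_deg).
exists #|quads split_inc split_pos m k|,
  (\sum_(ab : 'I_(size Q) * 'I_(size Q)) (len ab.1 %/ k + len ab.2 %/ k).+1); split.
- exact: (card_rungs_le split_pos_inj split_no_2bridge split_no_3bridge split_no_4bridge
            split_pos_len).
- apply: (leq_trans (n := (\sum_(ab : 'I_(size Q) * 'I_(size Q)) ((len ab.1 + len ab.2) %/ k).+1) * k)).
    rewrite leq_mul2r; apply/orP; right; apply: leq_sum => ab _; rewrite ltnS.
    by rewrite leq_divRL // mulnDl leq_add ?leq_divM.
  apply: leq_trans (sum_divn_le _ _) _; rewrite card_prod card_ord mulnn leq_add2l.
  rewrite -(pair_bigA _ (fun a b => len a + len b)) /= ps_sizeE.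
  under eq_bigr do rewrite big_split /= sum_nat_const card_ord.
  by rewrite big_split /= -big_distrr /= sum_nat_const card_ord mul2n -addnn.
exact: (quads_bound split_pos_inj split_no_2bridge split_no_3bridge split_deg m0 k0).
Qed.

End SplitSystem.

(** * Asymptotics *)

From Stdlib Require Import Reals Lra.
Open Scope R_scope.

Ltac positivity := repeat first [apply pow_lt | apply Rmult_lt_0_compat]; lra.

(** Splitting loses at most half the incidences and leaves at most [3 * p] blocks, so [E] is of
    order at least [L ^ 2 / p]; each edge carries at least [D ^ 2 / 4] rungs. *)
Lemma rungs_lower_bound (n p L D m I B E Rg : R) :
  0 < n -> 0 < p -> 100 * (n + p) <= L -> 2 * n * D <= L -> L <= 2 * n * (D + 1) ->
  p * m <= L -> L <= p * (m + 1) -> 0 <= B -> 0 <= E ->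
  L <= I + n * D -> I <= L -> I ^ 2 <= B * (I + 2 * E) -> B * m <= p * m + L ->
  E * (D - 3) ^ 2 <= Rg ->
  L ^ 2 * D ^ 2 <= 192 * p * Rg /\ L <= 4 * n * D /\ 6 <= D.
Proof.
move=> n0 p0 hL hD1 hD2 hm1 hm2 B0 E0 hI1 hI2 hE hB hR.
have D6 : 6 <= D by nra.
have m1 : 1 <= m by nra.
have B3 : B <= 3 * p by apply: (Rmult_le_reg_r m); nra.
have LI : L / 2 <= I by nra.
have E1 : L ^ 2 <= 48 * p * E.
  have h1 : B * (I + 2 * E) <= 3 * p * (L + 2 * E) by apply: Rmult_le_compat; nra.
  have h2 : (L / 2) ^ 2 <= I ^ 2 by apply: pow_incr; nra.
  nra.
have D2 : D ^ 2 <= 4 * (D - 3) ^ 2 by nra.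
have h3 : L ^ 2 * D ^ 2 <= 48 * p * E * (4 * (D - 3) ^ 2) by apply: Rmult_le_compat; nra.
split; [|split] => //; last by nra.
apply: Rle_trans h3 _.
have -> : 48 * p * E * (4 * (D - 3) ^ 2) = 192 * p * (E * (D - 3) ^ 2) by ring.
apply: Rmult_le_compat_l => //; lra.
Qed.

(** The case of boundedly many rungs per pair of paths, where most rungs might have no close
    companion; it yields the term [n^(1/2) p^(3/4)]. *)
Lemma few_rungs (n p L D Rg : R) :
  0 < n -> 0 < p -> 0 < L -> L ^ 2 * D ^ 2 <= 192 * p * Rg -> L <= 4 * n * D ->
  Rg <= 4 * p ^ 2 -> L ^ 4 <= 12288 * (n ^ 2 * p ^ 3).
Proof.
move=> n0 p0 L0 h1 h2 h3.
have h4 : L ^ 2 <= (4 * n * D) ^ 2 by apply: pow_incr; lra.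
have h5 : L ^ 2 * L ^ 2 <= L ^ 2 * (4 * n * D) ^ 2 by apply: Rmult_le_compat_l; nra.
have h6 : 192 * p * Rg <= 192 * p * (4 * p ^ 2) by apply: Rmult_le_compat_l; lra.
have h7 : 16 * n ^ 2 * (L ^ 2 * D ^ 2) <= 16 * n ^ 2 * (768 * p ^ 3).
  by apply: Rmult_le_compat_l; nra.
nra.
Qed.

(** The left case is that clean pairs of quads dominate, the right one that unclean pairs do. Either
    way the lower bound on [T] coming from [Rg] is compared with the upper bound, and [p * m <= L]
    removes [m]. *)
Lemma quads_dichotomy (p L D m k T Rg : R) :
  0 < p -> 0 < L -> 0 < D -> 0 < m -> 0 < k -> 0 <= T ->
  L ^ 2 * D ^ 2 <= 192 * p * Rg -> p * m <= L -> 0 <= Rg -> Rg <= 2 * T ->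
  T ^ 2 <= L * m * D * k * (L * k ^ 2 * D ^ 3 + 3 * T) ->
  L <= 294912 * p * k ^ 3 \/ D <= 2304 * k.
Proof.
move=> p0 L0 D0 m0 k0 T0 h1 pm R0 RT h2.
have c0 : 0 < L * m * D * k by positivity.
have LD0 : 0 < L ^ 3 * D ^ 4 by positivity.
have k30 : 0 < k ^ 3 by positivity.
case: (Rle_lt_dec (3 * T) (L * k ^ 2 * D ^ 3)) => h3; [left|right].
  have h4 : T ^ 2 <= L * m * D * k * (2 * (L * k ^ 2 * D ^ 3)).
    by apply: Rle_trans h2 _; apply: Rmult_le_compat_l; lra.
  have h5 : Rg ^ 2 <= (2 * T) ^ 2 by apply: pow_incr.
  have h6 : (L ^ 2 * D ^ 2) ^ 2 <= (192 * p * Rg) ^ 2.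
    by apply: pow_incr; split=> //; nra.
  have h7 : (192 * p) ^ 2 * Rg ^ 2 <= (192 * p) ^ 2 * (4 * (L * m * D * k * (2 * (L * k ^ 2 * D ^ 3)))).
    by apply: Rmult_le_compat_l; nra.
  have h8 : 294912 * p * (p * m) * (L ^ 2 * D ^ 4 * k ^ 3) <= 294912 * p * L * (L ^ 2 * D ^ 4 * k ^ 3).
    apply: Rmult_le_compat_r; last by apply: Rmult_le_compat_l; lra.
    by apply: Rlt_le; positivity.
  by apply: (Rmult_le_reg_l (L ^ 3 * D ^ 4)) => //; nra.
have T1 : 0 < T.
  have : 0 < L * k ^ 2 * D ^ 3 by positivity.
  lra.
have h4 : T <= 6 * (L * m * D * k).
  apply: (Rmult_le_reg_l T) => //.
  have : L * m * D * k * (L * k ^ 2 * D ^ 3 + 3 * T) <= L * m * D * k * (6 * T).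
    by apply: Rmult_le_compat_l; lra.
  nra.
have h5 : 192 * p * Rg <= 192 * p * (12 * (L * m * D * k)) by apply: Rmult_le_compat_l; lra.
have h6 : 2304 * (p * m) * (L * D * k) <= 2304 * L * (L * D * k).
  by apply: Rmult_le_compat_r; [nra|lra].
apply: (Rmult_le_reg_l (L ^ 2 * D)); first by positivity.
nra.
Qed.

(** Eliminating [Rg] and then [D] gives [k * L ^ 3 = O(n ^ 2 * p ^ 2)]; each alternative bounds [k]
    from below and so removes it. *)
Lemma power_bound (n p L D k Rg : R) :
  0 < n -> 0 < p -> 0 < L -> 0 < D -> 0 < k ->
  L ^ 2 * D ^ 2 <= 192 * p * Rg -> L <= 4 * n * D ->
  k * Rg <= 16 * (p * L) ->
  L <= 294912 * p * k ^ 3 \/ D <= 2304 * k ->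
  L ^ 10 <= 294912 * 49152 ^ 3 * (n ^ 6 * p ^ 7) \/ L ^ 4 <= 9216 * 49152 * (n ^ 3 * p ^ 2).
Proof.
move=> n0 p0 L0 D0 k0 h1 h2 h3 h4.
have h5 : k * L * D ^ 2 <= 3072 * p ^ 2.
  apply: (Rmult_le_reg_l L) => //.
  have : k * (L ^ 2 * D ^ 2) <= k * (192 * p * Rg) by apply: Rmult_le_compat_l; lra.
  have : 192 * p * (k * Rg) <= 192 * p * (16 * (p * L)) by apply: Rmult_le_compat_l; lra.
  nra.
have h6 : k * L ^ 3 <= 49152 * (n ^ 2 * p ^ 2).
  have a1 : L ^ 2 <= (4 * n * D) ^ 2 by apply: pow_incr; lra.
  have a2 : k * L * L ^ 2 <= k * L * (4 * n * D) ^ 2 by apply: Rmult_le_compat_l; nra.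
  have a3 : 16 * n ^ 2 * (k * L * D ^ 2) <= 16 * n ^ 2 * (3072 * p ^ 2).
    by apply: Rmult_le_compat_l; nra.
  nra.
have kL0 : 0 < k * L ^ 3 by positivity.
case: h4 => h4; [left|right].
  have a1 : (k * L ^ 3) ^ 3 <= (49152 * (n ^ 2 * p ^ 2)) ^ 3 by apply: pow_incr; lra.
  have a2 : L * L ^ 9 <= 294912 * p * k ^ 3 * L ^ 9.
    by apply: Rmult_le_compat_r => //; apply: pow_le; lra.
  have a3 : 294912 * p * (k * L ^ 3) ^ 3 <= 294912 * p * (49152 * (n ^ 2 * p ^ 2)) ^ 3.
    by apply: Rmult_le_compat_l; lra.
  have e1 : L ^ 10 = L * L ^ 9 by ring.
  have e2 : 294912 * p * k ^ 3 * L ^ 9 = 294912 * p * (k * L ^ 3) ^ 3 by ring.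
  have e3 : 294912 * p * (49152 * (n ^ 2 * p ^ 2)) ^ 3
     = 294912 * 49152 ^ 3 * (n ^ 6 * p ^ 7) by ring.
  by rewrite e1 -e3; apply: Rle_trans a2 _; rewrite e2.
have a1 : L <= 9216 * n * k.
  have : 4 * n * D <= 4 * n * (2304 * k) by apply: Rmult_le_compat_l; lra.
  lra.
have a2 : L * L ^ 3 <= 9216 * n * k * L ^ 3 by apply: Rmult_le_compat_r => //; apply: pow_le; lra.
have a3 : 9216 * n * (k * L ^ 3) <= 9216 * n * (49152 * (n ^ 2 * p ^ 2)).
  by apply: Rmult_le_compat_l; lra.
nra.
Qed.

(** * Passing from natural to real numbers *)

Lemma INR_leq (a b : nat) : (a <= b)%nat -> INR a <= INR b.
Proof. by move/leP; apply: le_INR. Qed.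

Lemma INR_addn (a b : nat) : INR (a + b)%nat = INR a + INR b.
Proof. exact: plus_INR. Qed.

Lemma INR_muln (a b : nat) : INR (a * b)%nat = INR a * INR b.
Proof. exact: mult_INR. Qed.

Lemma INR_expn (a k : nat) : INR (expn a k) = INR a ^ k.
Proof. by elim: k => [|k IH] //; rewrite expnS INR_muln IH. Qed.

Lemma INR_subn (a b : nat) : (b <= a)%nat -> INR (a - b)%nat = INR a - INR b.
Proof. by move/leP; apply: minus_INR. Qed.

Lemma INR_pos (a : nat) : (0 < a)%nat -> 0 < INR a.
Proof. by move/ltP; apply: lt_0_INR. Qed.

Definition INR_simpl := (INR_addn, INR_muln, INR_expn, S_INR).

Lemma ps_size_power_bounds (n : nat) (Q : seq (seq 'I_n)) :
  (0 < n)%nat -> (0 < size Q)%nat -> all uniq Q -> bridge_girth_gt Q 4 ->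
  let L := INR (ps_size Q) in let p := INR (size Q) in
  [\/ L <= 294912 * (INR n + p),
      L ^ 4 <= 12288 * (INR n ^ 2 * p ^ 3),
      L ^ 10 <= 294912 * 49152 ^ 3 * (INR n ^ 6 * p ^ 7) |
      L ^ 4 <= 9216 * 49152 * (INR n ^ 3 * p ^ 2)].
Proof.
move=> n0 p0 uQ gQ L p.
have n0' := INR_pos n0; have p0' : 0 < p := INR_pos p0.
case: (Rle_lt_dec L (100 * (INR n + p))) => hL; first by constructor 1; lra.
have L0 : 0 < L by lra.
(* Half the average degree and the average length, rounded down. *)
pose D := (ps_size Q %/ (2 * n))%nat; pose m := (ps_size Q %/ size Q)%nat.
have hD1 : 2 * INR n * INR D <= L.
  have := INR_leq (leq_divM (ps_size Q) (2 * n)); rewrite -/D !INR_simpl /= -/L; lra.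
have hD2 : L <= 2 * INR n * (INR D + 1).
  have /ltnW/INR_leq := @ltn_ceil (ps_size Q) (2 * n) ltac:(lia).
  rewrite -/D !INR_simpl /= -/L; lra.
have hm1 : p * INR m <= L.
  have := INR_leq (leq_divM (ps_size Q) (size Q)); rewrite -/m !INR_simpl /= -/L -/p; lra.
have hm2 : L <= p * (INR m + 1).
  have /ltnW/INR_leq := @ltn_ceil (ps_size Q) (size Q) p0.
  rewrite -/m !INR_simpl /= -/L -/p; lra.
have D0 : (0 < D)%nat.
  by rewrite lt0n; apply/eqP => e; move: hD2; rewrite e /=; nra.
have m0 : (0 < m)%nat.
  by rewrite lt0n; apply/eqP => e; move: hm2; rewrite e /=; nra.
have D3 : (3 <= D)%nat.
  by apply/leP/INR_le => /=; nra.
have [I [B [E [Rg [[i1 i2 i3 i4 i5] i6]]]]] := counting_inequalities uQ gQ D0 m0.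
have {}i1 := INR_leq i1; have {}i2 := INR_leq i2; have {}i3 := INR_leq i3.
have {}i4 := INR_leq i4; have {}i5 := INR_leq i5.
rewrite !INR_simpl -/L in i1; rewrite -/L in i2; rewrite !INR_simpl /= -/L -/p in i3 i4.
rewrite INR_muln INR_expn (INR_subn D3) [INR 3]/= in i5.
have [j1 [j2 j3]] : L ^ 2 * INR D ^ 2 <= 192 * p * INR Rg /\ L <= 4 * INR n * INR D /\ 6 <= INR D.
  have hB := pos_INR B; have hE := pos_INR E.
  by apply: (@rungs_lower_bound _ _ _ _ (INR m) (INR I) (INR B) (INR E)) => //; lra.
case: (Rle_lt_dec (INR Rg) (4 * p ^ 2)) => hR; first by constructor 2; exact: (few_rungs n0' p0' L0 j1 j2 hR).
have R0 : 0 < INR Rg by have := pow_lt _ 2 p0'; lra.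
have R0' : (0 < Rg)%nat by apply/ltP/INR_lt.
(* With [k = k' + 1], [8 * p * L <= k * Rg]; together with [4 * p ^ 2 < Rg] this makes the keys at
   most half of the rungs, so [Rg <= 2 * T]. *)
pose k' := (8 * (size Q * ps_size Q) %/ Rg)%nat.
have k1 : 8 * (p * L) <= INR k'.+1 * INR Rg.
  have /ltnW/INR_leq := @ltn_ceil (8 * (size Q * ps_size Q)) Rg R0'.
  rewrite -/k' !INR_simpl -/L -/p [INR 0]/=; lra.
have k2 : INR k' * INR Rg <= 8 * (p * L).
  have := INR_leq (leq_divM (8 * (size Q * ps_size Q)) Rg).
  rewrite -/k' !INR_simpl -/L -/p [INR 0]/=; lra.
have [T [K [t1 t2 t3]]] := i6 k'.+1 isT.
have {}t1 := INR_leq t1; have {}t2 := INR_leq t2; have {}t3 := INR_leq t3.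
rewrite INR_addn in t1; rewrite !(INR_addn, INR_muln, INR_expn) -/L -/p [INR 2]/= in t2.
rewrite !(INR_addn, INR_muln, INR_expn) [INR 3]/= in t3.
have kpos := INR_pos (isT : (0 < k'.+1)%nat); have mpos := INR_pos m0; have Dpos := INR_pos D0.
move: (INR k'.+1) k1 kpos t2 t3 (S_INR k') => k k1 kpos t2 t3 kE.
have RT : INR Rg <= 2 * INR T.
  have : 2 * INR K <= INR Rg.
    apply: (Rmult_le_reg_r k) => //.
    have : 4 * p ^ 2 * k <= INR Rg * k by apply: Rmult_le_compat_r; lra.
    lra.
  lra.
have T0 := pos_INR T.
have t4 : INR T ^ 2 <= L * INR m * INR D * k * (L * k ^ 2 * INR D ^ 3 + 3 * INR T).
  have I0 := pos_INR I; have c : 0 < INR m * INR D * k by positivity.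
  have c' : 0 < k ^ 2 * INR D ^ 3 by positivity.
  have a1 : INR I * (INR m * INR D * k) <= L * (INR m * INR D * k).
    by apply: Rmult_le_compat_r; lra.
  have a2 : INR I * (k ^ 2 * INR D ^ 3) <= L * (k ^ 2 * INR D ^ 3).
    by apply: Rmult_le_compat_r; lra.
  have a3 : 0 <= INR I * (k ^ 2 * INR D ^ 3) by apply: Rmult_le_pos; lra.
  have a4 : 0 <= INR I * (INR m * INR D * k) by apply: Rmult_le_pos; lra.
  apply: Rle_trans t3 _; rewrite !Rmult_assoc -!Rmult_assoc.
  by apply: Rmult_le_compat; lra.
have dich := quads_dichotomy p0' L0 Dpos mpos kpos T0 j1 hm1 (Rlt_le _ _ R0) RT t4.
(* If [k' = 0] then [k = 1] and the dichotomy already gives [L = O(n + p)]. Otherwise [k <= 2 * k'],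
   whence the upper bound on [k * Rg]. *)
case: (posnP k') => [k0|k'0].
  rewrite k0 [INR 0]/= Rplus_0_l in kE.
  by constructor 1; case: dich; rewrite kE => dich; nra.
have k'1 := INR_leq k'0; rewrite [INR 1]/= in k'1.
have kR : k * INR Rg <= 16 * (p * L) by nra.
by case: (power_bound n0' p0' L0 Dpos kpos j1 j2 kR dich) => h; [constructor 3|constructor 4].
Qed.

(** In logarithms, comparing monomials becomes linear arithmetic. *)
Lemma ln_monomial_bound (x n p c : R) (N a b : nat) :
  0 < x -> 0 < n -> 0 < p -> 0 < c -> x ^ N <= c * (n ^ a * p ^ b) ->
  INR N * ln x <= ln c + (INR a * ln n + INR b * ln p).
Proof.
move=> x0 n0 p0 c0 h; rewrite -!ln_pow // -ln_mult; [|positivity|positivity].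
rewrite -ln_mult //; last by positivity.
by case: h => [/ln_increasing h|->]; [apply/Rlt_le/h; positivity|lra].
Qed.

Theorem theorem3p4 :
  exists C : R, 0 < C /\
    forall (n p : nat) (P : seq (seq 'I_n)),
      (0 < n)%nat -> (0 < p)%nat ->
      @is_path_system n p P -> bridge_girth_gt P 4 ->
      INR (ps_size P) <=
        C * (Rpower (INR n) (3/4) * Rpower (INR p) (1/2)
             + Rpower (INR n) (5/8) * Rpower (INR p) (11/16)
             + INR n + INR p).
Proof.
pose C := 294912 * 49152 ^ 3; have C1 : 1 < C by rewrite /C; lra.
exists C; split=> [|n p Q n0 p0 [sQ uQ] gQ]; first by lra.
subst p; have n0' := INR_pos n0; have p0' := INR_pos p0.
have := ps_size_power_bounds n0 p0 uQ gQ; cbv zeta; rewrite -/C.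
move: (INR n) (INR (size Q)) (INR (ps_size Q)) (pos_INR (ps_size Q)) n0' p0' => {gQ uQ n0 p0}.
move=> a b x x0 a0 b0 h.
have pos1 := exp_pos (3/4 * ln a); have pos2 := exp_pos (1/2 * ln b).
have pos3 := exp_pos (5/8 * ln a); have pos4 := exp_pos (11/16 * ln b).
have e1 : 0 < C * (exp (3/4 * ln a) * exp (1/2 * ln b)) by positivity.
have e2 : 0 < C * (exp (5/8 * ln a) * exp (11/16 * ln b)) by positivity.
have e3 : 0 < C * a by positivity.
have e4 : 0 < C * b by positivity.
rewrite /Rpower !Rmult_plus_distr_l.
case: (Rle_lt_or_eq_dec 0 x x0) => [{}x0|<-]; last by lra.
(* Positivity of [ln C] absorbs the fraction of it left after dividing by the exponent 4 or 10. *)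
have lC : 0 < ln C by rewrite -ln_1; apply: ln_increasing; lra.
have to_exp y z : 0 < y -> ln x <= ln C + z -> y = exp z -> x <= C * y.
  move=> y0 h1 e; rewrite -(exp_ln x) // -(exp_ln C); last lra.
  by rewrite e -exp_plus; case: h1 => [/exp_increasing/Rlt_le|->] //; lra.
have t1 : ln x <= ln C + (3/4 * ln a + 1/2 * ln b) -> x <= C * (exp (3/4 * ln a) * exp (1/2 * ln b)).
  by move=> h1; apply: to_exp h1 _; [positivity|rewrite exp_plus].
have t2 : ln x <= ln C + (5/8 * ln a + 11/16 * ln b) -> x <= C * (exp (5/8 * ln a) * exp (11/16 * ln b)).
  by move=> h1; apply: to_exp h1 _; [positivity|rewrite exp_plus].
have t3 : ln x <= ln C + ln b -> x <= C * b by move=> h1; apply: to_exp h1 _ => //; rewrite exp_ln.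
have lnC c : 0 < c -> c <= C -> ln c <= ln C.
  by move=> c0 [/ln_increasing h1|->]; [apply/Rlt_le/h1|lra].
case: h => [h|h|h|h].
- have : 294912 * (a + b) <= C * (a + b) by apply: Rmult_le_compat_r; [lra|rewrite /C; lra].
  lra.
- have c1 : ln 12288 <= ln C by apply: lnC; rewrite /C; lra.
  have {h} := ln_monomial_bound x0 a0 b0 (_ : 0 < 12288) h => /(_ ltac:(lra)) /= h.
  (* At [p = n^2] the monomials [n^(1/2) p^(3/4)], [n^(3/5) p^(7/10)], [n^(5/8) p^(11/16)] and [p]
     all agree: below it the third dominates the first two, above it [p] does. *)
  by case: (Rle_lt_dec (ln b) (2 * ln a)) => ab; [have := t2 ltac:(lra)|have := t3 ltac:(lra)]; lra.
- have {h} /= h := ln_monomial_bound x0 a0 b0 (Rlt_trans _ _ _ Rlt_0_1 C1) h.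
  by case: (Rle_lt_dec (ln b) (2 * ln a)) => ab; [have := t2 ltac:(lra)|have := t3 ltac:(lra)]; lra.
have c1 : ln (9216 * 49152) <= ln C by apply: lnC; rewrite /C; lra.
have {h} := ln_monomial_bound x0 a0 b0 (_ : 0 < 9216 * 49152) h => /(_ ltac:(lra)) /= h.
by have := t1 ltac:(lra); lra.
Qed.
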